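(* Let $[0,\infty]$ be the compactification of $[0,\infty)$ by the point $\infty$ (with its usual order topology), and let $\phi:[0,\infty]\to[0,\infty]$ be the continuous map given by $\phi(x)=\left|1-\frac1x\right|$ for $0<x<\infty$, $\phi(0)=\infty$, $\phi(\infty)=1$. Then, on $[0,\infty]$, $\phi$ is topologically mixing, the irrational periodic points of $\phi$ are dense, and the topological entropy of $\phi$ is $\log\lambda$, where $\lambda$ is the unique positive zero of the polynomial $x^3-2x-1$.
   Context: A continuous map $\phi$ of a topological space is topologically mixing if for any nonempty open sets $U,V$ there is $N$ such that $\phi^n(U)\cap V\neq\emptyset$ for all $n\ge N$. An irrational periodic point is a periodic point of $\phi$ that is an irrational number in $(0,\infty)$. Topological entropy is the usual topological entropy of a continuous map on a compact topological space (defined via open covers). $\phi^n$ denotes the $n$-th iterate of $\phi$. *)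

(* Defs.v *)
From HB Require Import structures.
From mathcomp Require Import all_boot all_order all_algebra.
From mathcomp Require Import all_classical all_reals all_analysis.

Set Implicit Arguments.
Unset Strict Implicit.
Unset Printing Implicit Defensive.

Import Order.TTheory GRing.Theory Num.Theory.
Import numFieldNormedType.Exports.

Local Open Scope classical_set_scope.
Local Open Scope ring_scope.

Section dynamics.
Context {T : topologicalType}.
Implicit Types (f : T -> T) (U V : set (set T)).

Definition topologically_mixing f : Prop :=
  forall A B : set T, open A -> A !=set0 -> open B -> B !=set0 ->
    exists N : nat, forall n : nat, (N <= n)%N ->
      (iter n f @` A) `&` B !=set0.

Definition periodic_point f (x : T) : Prop :=
  exists2 n : nat, (0 < n)%N & iter n f x = x.

Definition covering U : Prop := \bigcup_(A in U) A = [set: T].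

Definition open_covering U : Prop := U `<=` open /\ covering U.

Definition cover_join U V : set (set T) := [set A `&` B | A in U & B in V].

Definition cover_preimage f U : set (set T) := [set f @^-1` A | A in U].

(* U \/ f^-1 U \/ ... \/ f^-(n-1) U; the trivial cover {T} is neutral. *)
Definition iterated_join f U (n : nat) : set (set T) :=
  \big[cover_join/[set [set: T]]]_(i < n) cover_preimage (iter i f) U.

End dynamics.

Section entropy.
Context {T : topologicalType} (R : realType).
Implicit Types (f : T -> T) (U : set (set T)).

(* Least cardinality of a finite subcover.  When there is a finite subcover
   (in particular for an open cover of a compact space), this infimum of
   natural numbers is attained. *)
Definition cover_number U : R :=
  inf [set n%:R | n in [set n : nat |
    exists V, [/\ V `<=` U, covering V & (V #= `I_n)%card]]].

Definition cover_entropy U : R := ln (cover_number U).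

(* The limit exists when f is continuous, T compact and U an open cover, by
   subadditivity. *)
Definition entropy_rel f U : R :=
  limn (fun n : nat => n%:R^-1 * cover_entropy (iterated_join f U n)).

Definition topological_entropy f : \bar R :=
  ereal_sup [set (entropy_rel f U)%:E | U in open_covering].

End entropy.

Section phi.
Context (R : realType).

(* [0, oo], a subtype of \bar R with the induced topology.  This is its order
   topology because \bar R carries the order topology and the interval is
   order-convex. *)
Definition ext_halfline : set (\bar R) := [set x | (0 <= x)%E].

(* The values outside [0, oo] are irrelevant. *)
Definition phi_ereal (x : \bar R) : \bar R :=
  match x with
  | r%:E => if r == 0 then +oo%E else `|1 - r^-1|%:E
  | +oo%E => 1%E
  | -oo%E => 0%E
  end.

Lemma phi_ereal_ge0 (x : \bar R) : phi_ereal x \in ext_halfline.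
Proof.
rewrite inE /ext_halfline /=; case: x => [r| |] //=.
by case: eqP => _ //; rewrite ?leey// lee_fin normr_ge0.
Qed.

Definition phi (x : ext_halfline) : ext_halfline :=
  exist _ (phi_ereal (set_val x)) (phi_ereal_ge0 (set_val x)).

Definition irrational_periodic_points : set ext_halfline :=
  [set x | periodic_point phi x /\
    exists r : R, [/\ 0 < r, irrational r & set_val x = r%:E]].

End phi.

(* Main.v *)
Require Import Defs.
From mathcomp Require Import all_boot all_order all_algebra.
From mathcomp Require Import all_classical all_reals all_analysis.
From mathcomp Require Import ring lra zify.

Import Order.TTheory GRing.Theory Num.Theory.
Import numFieldNormedType.Exports.

Local Open Scope classical_set_scope.
Local Open Scope ring_scope.

(** The coordinate t = 1/(1+x) identifies [0,oo] with [0,1] and turns phi into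
the map F, which increases from 1/2 to 1 on [0,1/2] and decreases from 1 to 0
on [1/2,1].  The turning point 1/2 lies on the cycle 1/2 -> 1 -> 0 -> 1/2, so
the two halves of [0,1] form a Markov partition with transition matrix
((0,1),(1,1)), whose spectral radius is the golden ratio, the positive zero of
x^3 - 2x - 1 = (x + 1)(x^2 - x - 1).

Mixing.  On fractions F is the subtractive Euclidean algorithm, so every
rational orbit reaches 1 (rational_hits1).  An interval contains a rational,
hence some iterate maps it onto a neighbourhood of 1, and the third iterate of
F, although it only repels neutrally from 1, expands such a neighbourhood to
all of [0,1] in finitely many steps (F3_cover).  Thus each interval is
eventually mapped onto [0,1] (iterF_exact), which gives mixing and, with
the intermediate value theorem, a periodic point in each interval
(periodic_in_itv).  A periodic point off the cycle {0,1/2,1} is irrational,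
since rational orbits end in that cycle.

Entropy, upper bound.  Take a grid so fine that every grid cell lies in a
member of the cover (theta_lebesgue, grid), and add to it all preimages of its
points up to order n.  Two points that this finite set does not separate
follow each other cell by cell for n steps (inseparable_iter), so the n-th
join has a subcover whose size is at most linear in the number of points of
the set.  Giving the points of [1/2,1] the weight lambda and the others the
weight 1, a left eigenvector of the transition matrix, makes the total weight
of the preimages of a set at most lambda times its own (mass_preimages_le);
so there are O(lambda^n) points.

Entropy, lower bound.  Because of the turning point there may be no single
cover that realizes the entropy, so for each k the cover by open sets on which
the k-th iterate has at most one fold is used (fold_cover).  A member of its
(nk)-th join contains at most 2^n preimages of order nk of a given point
(size_fold_le), while x = 1/2, which is off the critical cycle, has at least
lambda^(nk) of them (size_preorbit).  So this cover has entropy at least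
ln lambda - (ln 2)/k.  The limit that defines it exists by submultiplicativity
and Fekete's lemma (coded_joinM, fekete). *)

Set Implicit Arguments.
Unset Strict Implicit.
Unset Printing Implicit Defensive.

(** * Minimal subcovers as codings, and their growth *)

Section codes.
Context {T : topologicalType}.
Implicit Types (U V : set (set T)) (K : nat).

(** Colouring the points with K colours so that each colour class lies in a member
of the cover is the same as choosing a subcover of at most K members; unlike
subcovers, colourings are easy to multiply and to pull back. *)
Definition coded U K : Prop :=
  exists2 g : T -> nat, (forall x, (g x < K)%N) &
    forall x, exists2 A, U A & forall y, g y = g x -> A y.

Lemma coded_subcover U K : coded U K ->
  exists2 n, (n <= K)%N &
    exists V, [/\ V `<=` U, covering V & (V #= `I_n)%card].
Proof.
case=> g gK gU.
pose a x := xget set0 [set A | U A /\ forall y, g y = g x -> A y].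
have aP x : U (a x) /\ forall y, g y = g x -> a x y.
  rewrite /a; case: xgetP => [A _ //|h]; have [A UA Ag] := gU x.
  by exfalso; apply: (h A).
have ag x y : g x = g y -> a x = a y by rewrite /a => ->.
have [h hP] : exists h : nat -> set T, forall x, h (g x) = a x.
  exists (fun c => xget set0 [set A | exists2 x, g x = c & a x = A]) => x.
  case: xgetP => [A _ [y /ag <- <-] //|H].
  by exfalso; apply: (H (a x)); exists x.
have Vcard : (range a #<= `I_K)%card.
  have -> : range a = h @` (range g).
    apply/seteqP; split=> A /=.
      by case=> x _ <-; exists (g x) => //; exists x.
    by case=> _ [x _ <-] <-; exists x.
  apply: card_le_trans (card_image_le _ _) _.
  by apply: subset_card_le => _ [x _ <-] /=; exact: gK.
have Vfin : finite_set (range a).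
  by apply: card_le_finite Vcard _; exact: finite_II.
have [n Vn] := Vfin; exists n.
  rewrite -card_le_II; apply: card_le_trans Vcard.
  by rewrite (card_le_eql (card_esym Vn)) //.
exists (range a); split => //.
- by move=> _ [x _ <-]; case: (aP x).
- apply/seteqP; split=> // x _; exists (a x); first by exists x.
  by case: (aP x) => _; apply.
Qed.

Lemma subcover_coded U n V :
  V `<=` U -> covering V -> (V #= `I_n)%card -> coded U n.
Proof.
move=> VU Vcov /card_esym /card_set_bijP[f fbij].
have /choice[g gP] : forall x, exists c, (c < n)%N /\ f c x.
  move=> x; have : (\bigcup_(A in V) A) x by rewrite Vcov.
  case=> A VA Ax; have [_ _ /(_ _ VA)[c /= cn fc]] := fbij.
  by exists c; rewrite fc.
exists g => [x|x]; first by case: (gP x).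
have [gx fx] := gP x; exists (f (g x)).
  by apply: VU; case: fbij => fV _ _; exact: fV.
by move=> y <-; case: (gP y).
Qed.

End codes.

Section cover_number.
Context {T : topologicalType} (R : realType).
Implicit Types (f : T -> T) (U : set (set T)).

Lemma cover_numberP U K : coded U K ->
  exists n, [/\ cover_number R U = n%:R, coded U n, (n <= K)%N &
    forall m, coded U m -> (n <= m)%N].
Proof.
move=> UK.
have ex : exists n, `[< coded U n >] by exists K; apply/asboolP.
have [n /asboolP Un nmin] := ex_minnP ex; exists n.
have nle m : coded U m -> (n <= m)%N by move=> h; apply: nmin; apply/asboolP.
split=> //; last exact: nle.
rewrite /cover_number; set S := (X in inf X).
have Slb : lbound S n%:R.
  move=> _ [m [V [VU Vcov Vm]] <-]; rewrite ler_nat; apply: nle.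
  exact: subcover_coded VU Vcov Vm.
have Sn : S n%:R.
  exists n => //; have [m mn [V [VU Vcov Vm]]] := coded_subcover Un.
  have nm : (n <= m)%N by apply: nle; exact: subcover_coded VU Vcov Vm.
  by have -> /= : n = m by [apply/eqP; rewrite eqn_leq nm mn]; exists V.
apply/eqP; rewrite eq_le; apply/andP; split.
- by apply: ge_inf => //; exists n%:R.
- by apply: lb_le_inf => //; exists n%:R.
Qed.

(** The join is described for an arbitrary sequence of maps, because unfolding it
from the left shifts the sequence. *)
Lemma join_preimageP U (g : nat -> T -> T) n A :
  (\big[cover_join/[set [set: T]]]_(i < n) cover_preimage (g i) U) A <->
  exists2 a : nat -> set T, (forall i, (i < n)%N -> U (a i)) &
    A = [set x | forall i, (i < n)%N -> a i (g i x)].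
Proof.
elim: n g A => [|n IH] g A.
  rewrite big_ord0; split=> [->|[a _ ->]].
    by exists (fun=> set0) => //; apply/seteqP; split.
  by apply/seteqP; split.
rewrite big_ord_recl; split.
  case=> _ [C UC <-] [B /(IH (fun i => g i.+1))[a aU ->] <-].
  exists (fun i => if i is j.+1 then a j else C).
    by case=> //= i; rewrite ltnS; exact: aU.
  apply/seteqP; split => x /=.
    by case=> Cx h [|i] //; rewrite ltnS; exact: h.
  by move=> h; split=> [|i ni]; [exact: (h 0%N) | exact: (h i.+1)].
case=> a aU ->.
exists (g 0%N @^-1` a 0%N); first by exists (a 0%N) => //; exact: aU.
exists [set x | forall i, (i < n)%N -> a i.+1 (g i.+1 x)].
  apply/(IH (fun i => g i.+1)); exists (fun i => a i.+1) => // i.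
  exact: (aU i.+1).
apply/seteqP; split => x /=.
  by case=> a0 h [|i] //; rewrite ltnS; exact: h.
by move=> h; split=> [|i ni]; [exact: (h 0%N) | exact: (h i.+1)].
Qed.

Lemma iterated_joinP f U n A : iterated_join f U n A <->
  exists2 a : nat -> set T, (forall i, (i < n)%N -> U (a i)) &
    A = [set x | forall i, (i < n)%N -> a i (iter i f x)].
Proof. exact: (join_preimageP U (fun i => iter i f)). Qed.

(** Submultiplicativity: pair the code of x with that of its m-th iterate, as
a number in base N. *)
Lemma coded_joinM f U m n M N :
  coded (iterated_join f U m) M -> coded (iterated_join f U n) N ->
  coded (iterated_join f U (m + n)) (M * N).
Proof.
case=> g gM gU [h hN hU].
exists (fun x => (g x * N + h (iter m f x))%N) => [x|x].
  apply: (@leq_trans ((g x).+1 * N)); last by rewrite leq_mul2r gM orbT.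
  by rewrite mulSn addnC ltn_add2r.
have [A /iterated_joinP[a aU ->] Ag] := gU x.
have [B /iterated_joinP[b bU ->] Bh] := hU (iter m f x).
exists [set y | forall i, (i < m + n)%N ->
  (if (i < m)%N then a i else b (i - m)%N) (iter i f y)].
  apply/iterated_joinP; exists (fun i => if (i < m)%N then a i else b (i - m)%N).
    move=> i imn; case: ltnP => im; first exact: aU.
    by apply: bU; rewrite ltn_subLR.
  by [].
move=> y e /=.
have N0 : (0 < N)%N by apply: leq_ltn_trans (hN x).
have eg : g y = g x.
  have := congr1 (divn^~ N) e.
  by rewrite !divnMDl// !divn_small ?addn0.
have eh : h (iter m f y) = h (iter m f x).
  by move: e; rewrite eg => /addnI.
move=> i imn; case: ltnP => im; first exact: Ag.
have := Bh _ eh (i - m)%N; rewrite ltn_subLR// => /(_ imn).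
by rewrite -iterD subnK.
Qed.

End cover_number.

Section fekete.
Context {R : realType} (a : nat -> R).
Hypothesis a_ge0 : forall n, 0 <= a n.
Hypothesis a0 : a 0%N = 0.
Hypothesis aD : forall m n, a (m + n)%N <= a m + a n.

Lemma subadditive_leM q m r : a (q * m + r)%N <= q%:R * a m + r%:R * a 1%N.
Proof.
elim: q => [|q IH].
  rewrite mul0n add0n mul0r add0r; elim: r => [|r IH]; first by rewrite a0 mul0r.
  by rewrite -addn1 (le_trans (aD _ _))// natrD mulrDl mul1r lerD2r.
rewrite mulSn -addnA (le_trans (aD _ _))// -addn1 natrD mulrDl mul1r.
by rewrite [q%:R * _ + _]addrC -addrA lerD2l.
Qed.

(** Fekete's lemma: if a m / m is close to the infimum of all quotients, writing
n = q m + r bounds a n / n by a m / m up to a term that tends to 0. *)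
Lemma fekete : cvgn (fun n => n%:R^-1 * a n).
Proof.
pose S := [set n%:R^-1 * a n | n in [set n | (0 < n)%N]].
have S0 : S !=set0 by exists (1%:R^-1 * a 1%N); exists 1%N.
have Slb : has_lbound S.
  by exists 0 => _ [n _ <-]; rewrite mulr_ge0 ?invr_ge0.
apply/cvg_ex; exists (inf S); apply/cvgrPdist_le => e e0.
have /(inf_lt S0) [_ [m /= m0 <-] me] : inf S < inf S + e / 2.
  by rewrite ltrDl divr_gt0.
have [N _ NP] : \forall n \near \oo, m%:R * a 1%N / (e / 2) <= n%:R.
  exact: nbhs_infty_ger.
near=> n.
have n0 : (0 < n)%N by near: n; exact: nbhs_infty_gt.
have nN : m%:R * a 1%N / (e / 2) <= n%:R.
  by apply: NP; near: n; exact: nbhs_infty_ge.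
have n0' : 0 < n%:R :> R by rewrite ltr0n.
have infn : inf S <= n%:R^-1 * a n by apply: ge_inf => //; exists n.
rewrite ler_norml; apply/andP; split; last by lra.
suff : n%:R^-1 * a n <= m%:R^-1 * a m + e / 2 by lra.
rewrite -(ler_pM2l n0') mulrA divff ?gt_eqF// mul1r mulrDr.
have h1 := subadditive_leM (n %/ m) m (n %% m); rewrite -divn_eq in h1.
apply: le_trans h1 _; apply: lerD.
  rewrite mulrA ler_wpM2r// ler_pdivlMr ?ltr0n// -natrM ler_nat.
  exact: leq_trunc_div.
rewrite ler_pdivrMr in nN; last by lra.
apply: le_trans nN; rewrite ler_wpM2r// ler_nat ltnW//.
exact: ltn_pmod.
Unshelve. all: by end_near.
Qed.

End fekete.

Section entropy_bounds.
Context {T : topologicalType} (R : realType).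
Variables (f : T -> T) (U : set (set T)) (x0 : T).
Hypothesis fin : forall n, exists K, coded (iterated_join f U n) K.

Let N n : R := cover_number R (iterated_join f U n).

Lemma cover_number_ge1 n : 1 <= N n.
Proof.
have [K /(cover_numberP R)[m [mE [g gm _] _ _]]] := fin n.
by rewrite /N mE ler1n; apply: leq_ltn_trans (gm x0).
Qed.

Lemma cover_entropy_cvg :
  cvgn (fun n => n%:R^-1 * cover_entropy R (iterated_join f U n)).
Proof.
apply: fekete => [n||m n]; first by rewrite ln_ge0// cover_number_ge1.
  suff h : coded (iterated_join f U 0) 1.
    apply/eqP; rewrite eq_le ln_ge0 ?cover_number_ge1// andbT ln_le0//.
    by have [m [-> _ m1 _]] := cover_numberP R h; rewrite lern1.
  exists (fun=> 0%N) => // x; exists setT => //.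
  by apply/iterated_joinP; exists (fun=> setT) => //; apply/seteqP; split.
have [K /(cover_numberP R)[a [aE aC _ _]]] := fin m.
have [L /(cover_numberP R)[b [bE bC _ _]]] := fin n.
have [c [cE _ cab _]] := cover_numberP R (coded_joinM aC bC).
have := cover_number_ge1 m; have := cover_number_ge1 n.
have := cover_number_ge1 (m + n).
rewrite /cover_entropy /N aE bE cE => c1 b1 a1.
rewrite -lnM ?posrE; try lra.
by rewrite ler_ln ?posrE -?natrM ?ler_nat//; [lra|rewrite natrM; nra].
Qed.

Lemma entropy_rel_le (C lambda : R) : 0 < C -> 0 < lambda ->
  (forall n, exists2 K, coded (iterated_join f U n) K &
    K%:R <= C * lambda ^+ n) ->
  entropy_rel R f U <= ln lambda.
Proof.
move=> C0 l0 H.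
have h n : cover_entropy R (iterated_join f U n) <= ln C + n%:R * ln lambda.
  have [K KC Kle] := H n; have [m [mE _ mK _]] := cover_numberP R KC.
  have := cover_number_ge1 n; rewrite /N mE => m1.
  rewrite mulr_natl -lnXn// -lnM ?posrE// ?exprn_gt0// /cover_entropy mE.
  rewrite ler_ln ?posrE ?mulr_gt0 ?exprn_gt0//; last by lra.
  by apply: le_trans Kle; rewrite ler_nat.
have cv : (fun n => n%:R^-1 * ln C + ln lambda) @ \oo --> ln lambda.
  rewrite -[X in _ --> X]add0r; apply: cvgD; last exact: cvg_cst.
  rewrite -[X in _ --> X](mul0r (ln C)); apply: cvgM; last exact: cvg_cst.
  by apply/gtr0_cvgV0; [exists 1%N => // n /= n1; rewrite ltr0n | exact: cvgr_idn].
rewrite /entropy_rel -(cvg_lim _ cv)//; apply: ler_lim.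
- exact: cover_entropy_cvg.
- by apply/cvg_ex; exists (ln lambda).
near=> n.
have n0 : 0 < n%:R :> R by rewrite ltr0n; near: n; exact: nbhs_infty_gt.
rewrite -(ler_pM2l n0) mulrA mulrDr mulrA divff ?gt_eqF// !mul1r.
exact: h.
Unshelve. all: by end_near.
Qed.

(** A bound along the multiples of k is enough because the whole sequence
converges. *)
Lemma entropy_rel_ge k (lambda : R) : (0 < k)%N -> 0 < lambda ->
  (forall n K, coded (iterated_join f U (n * k)) K ->
    lambda ^+ (n * k) <= K%:R * 2 ^+ n) ->
  ln lambda - k%:R^-1 * ln 2 <= entropy_rel R f U.
Proof.
move=> k0 l0 H.
set u := (fun n => n%:R^-1 * cover_entropy R (iterated_join f U n)).
have cu : u @ \oo --> entropy_rel R f U := cover_entropy_cvg.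
have ck : (fun n => (n * k)%N) @ \oo --> \oo.
  apply/cvgnyPge => A; near=> n; apply: (@leq_trans n); last by rewrite leq_pmulr.
  by near: n; exact: nbhs_infty_ge.
have cuk : (u \o (fun n => (n * k)%N)) @ \oo --> entropy_rel R f U.
  exact: cvg_comp ck cu.
rewrite -(cvg_lim _ cuk)//; apply: limr_ge.
  by apply/cvg_ex; eexists; exact: cuk.
near=> n.
have n0 : 0 < n%:R :> R by rewrite ltr0n; near: n; exact: nbhs_infty_gt.
have k0' : 0 < k%:R :> R by rewrite ltr0n.
have [K /(cover_numberP R)[m [mE mC _ _]]] := fin (n * k).
have := cover_number_ge1 (n * k); rewrite /N mE => m1.
rewrite /= /u /cover_entropy mE natrM -(ler_pM2l (mulr_gt0 n0 k0')) mulrA.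
rewrite divff ?mul1r ?mulf_neq0 ?gt_eqF//.
have -> : n%:R * k%:R * (ln lambda - k%:R^-1 * ln 2) =
  (n * k)%:R * ln lambda - n%:R * ln 2.
  by rewrite natrM; field; rewrite gt_eqF.
rewrite lerBlDr !mulr_natl -!lnXn// -lnM ?posrE ?exprn_gt0//; last by lra.
rewrite ler_ln ?posrE ?mulr_gt0 ?exprn_gt0//; last by lra.
exact: H.
Unshelve. all: by end_near.
Qed.

End entropy_bounds.

(** * The map in the coordinate t = 1/(1+x) *)

Section interval_map.
Context {R : realType}.
Implicit Types (s t u x y : R) (n k j : nat).

(** This is phi seen through t = 1/(1+x); the denominator never vanishes, so that
F is continuous on the whole line. *)
Definition F t : R := (1 - t) / (1 - t + `|1 - 2 * t|).

(** The inverse of F on [1/2,1]. *)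
Definition psi0 s : R := 1 / (1 + s).
(** The inverse of F on [0,1/2], defined on F [0,1/2] = [1/2,1]. *)
Definition psi1 s : R := (2 * s - 1) / (3 * s - 1).

Lemma F_den_gt0 t : 0 < 1 - t + `|1 - 2 * t|.
Proof. by case: (ger0P (1 - 2 * t)) => h; lra. Qed.

Lemma F_right t : 1/2 <= t -> F t = (1 - t) / t.
Proof. by move=> h; rewrite /F ler0_norm; [congr (_ / _); ring | lra]. Qed.

Lemma F_left t : t <= 1/2 -> F t = (1 - t) / (2 - 3 * t).
Proof. by move=> h; rewrite /F ger0_norm; [congr (_ / _); ring | lra]. Qed.

Lemma F_ge0 t : t <= 1 -> 0 <= F t.
Proof.
by move=> h; rewrite /F divr_ge0//; [lra | exact/ltW/F_den_gt0].
Qed.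

Lemma F_le1 t : F t <= 1.
Proof.
by rewrite /F ler_pdivrMr ?F_den_gt0// mul1r lerDl.
Qed.

Lemma F_continuous : continuous F.
Proof.
move=> t; rewrite /F.
have c1 : (fun t => 1 - t : R) @ t --> 1 - t.
  by apply: cvgB; [exact: cvg_cst|exact: cvg_id].
apply: cvgM => //; apply: cvgV; first by rewrite gt_eqF// F_den_gt0.
apply: cvgD => //; apply: cvg_norm; apply: cvgB; first exact: cvg_cst.
by apply: cvgM; [exact: cvg_cst|exact: cvg_id].
Qed.

Lemma iterF_continuous n : continuous (iter n F).
Proof.
elim: n => [|n IH] t; first exact: cvg_id.
exact: (@continuous_comp _ _ _ (iter n F) F t (IH t) (@F_continuous _)).
Qed.

Lemma iterF_itv n t : 0 <= t <= 1 -> 0 <= iter n F t <= 1.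
Proof.
elim: n => [//|n IH] /IH /andP[_ h]; by rewrite /= F_ge0// F_le1.
Qed.

Lemma F0 : F 0 = 1/2.
Proof. by rewrite F_left; [rewrite mulr0 !subr0 | lra]. Qed.

Lemma F_half : F (1/2) = 1.
Proof. by rewrite F_left//; field. Qed.

Lemma F1 : F 1 = 0.
Proof. by rewrite F_right; [rewrite subrr mul0r | lra]. Qed.

Lemma psi0_itv s : 0 <= s <= 1 -> 1/2 <= psi0 s <= 1.
Proof.
move=> h; rewrite /psi0 ler_pdivlMr ?ler_pdivrMr; lra.
Qed.

Lemma F_psi0 s : 0 <= s <= 1 -> F (psi0 s) = s.
Proof.
move=> h; rewrite F_right; last by case/andP: (psi0_itv h).
by rewrite /psi0; field; lra.
Qed.

Lemma psi1_itv s : 1/2 <= s <= 1 -> 0 <= psi1 s <= 1/2.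
Proof.
move=> h; rewrite /psi1 ler_pdivlMr ?ler_pdivrMr; lra.
Qed.

Lemma psi1_lt s : 1/2 <= s < 1 -> psi1 s < 1/2.
Proof. move=> h; rewrite /psi1 ltr_pdivrMr; lra. Qed.

Lemma F_psi1 s : 1/2 <= s <= 1 -> F (psi1 s) = s.
Proof.
move=> h; rewrite F_left; last by case/andP: (psi1_itv h).
rewrite /psi1; field; lra.
Qed.

Lemma F_le_right s t : 0 <= s -> 1/2 <= t -> (F t <= s) = (psi0 s <= t).
Proof.
move=> s0 t0; rewrite F_right// /psi0 ler_pdivrMr ?ler_pdivrMr; lra.
Qed.

Lemma F_ge_right s t : 0 <= s -> 1/2 <= t -> (s <= F t) = (t <= psi0 s).
Proof.
move=> s0 t0; rewrite F_right// /psi0 ler_pdivlMr ?ler_pdivlMr; lra.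
Qed.

Lemma F_le_left s t : 1/2 <= s -> t <= 1/2 -> (F t <= s) = (t <= psi1 s).
Proof.
move=> s0 t0; rewrite F_left// /psi1 ler_pdivrMr ?ler_pdivlMr; lra.
Qed.

Lemma F_ge_left s t : 1/2 <= s -> t <= 1/2 -> (s <= F t) = (psi1 s <= t).
Proof.
move=> s0 t0; rewrite F_left// /psi1 ler_pdivlMr ?ler_pdivrMr; lra.
Qed.

Lemma F_left_ge t : 0 <= t <= 1/2 -> 1/2 <= F t.
Proof. by move=> h; rewrite F_ge_left ?/psi1; lra. Qed.

Lemma psi0K z : 1/2 <= z <= 1 -> psi0 (F z) = z.
Proof. by move=> h; rewrite F_right ?/psi0; [field; lra|lra]. Qed.

Lemma psi1K z : 0 <= z <= 1/2 -> psi1 (F z) = z.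
Proof. by move=> h; rewrite F_left ?/psi1; [field; lra|lra]. Qed.

Lemma F_inj_right x y : 1/2 <= x <= 1 -> 1/2 <= y <= 1 -> F x = F y -> x = y.
Proof. by move=> hx hy e; rewrite -(psi0K hx) e psi0K. Qed.

Lemma F_inj_left x y : 0 <= x <= 1/2 -> 0 <= y <= 1/2 -> F x = F y -> x = y.
Proof. by move=> hx hy e; rewrite -(psi1K hx) e psi1K. Qed.

Lemma F_decr x y : 1/2 <= x -> x <= y -> y <= 1 -> F y <= F x.
Proof. by move=> hx xy hy; rewrite F_ge_right ?F_ge0 ?psi0K; lra. Qed.

Lemma F_incr x y : 0 <= x -> x <= y -> y <= 1/2 -> F x <= F y.
Proof. by move=> hx xy hy; rewrite F_ge_left ?F_left_ge ?psi1K; lra. Qed.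

(** In the coordinate t, the fraction b/(a+b) stands for x = a/b, and F replaces
the pair (a,b) by (|a-b|,a). *)
Lemma F_frac_le (a b : nat) : (0 < a)%N -> (a <= b)%N ->
  F (b%:R / (a + b)%:R) = a%:R / ((b - a) + a)%:R.
Proof.
move=> a0 ab; have a0' : 0 < a%:R :> R by rewrite ltr0n.
have ab' : a%:R <= b%:R :> R by rewrite ler_nat.
rewrite subnK// F_right natrD.
  by field; lra.
by rewrite ler_pdivlMr; lra.
Qed.

Lemma F_frac_ge (a b : nat) : (0 < b)%N -> (b <= a)%N ->
  F (b%:R / (a + b)%:R) = a%:R / ((a - b) + a)%:R.
Proof.
move=> b0 ba; have b0' : 0 < b%:R :> R by rewrite ltr0n.
have ab' : b%:R <= a%:R :> R by rewrite ler_nat.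
rewrite F_left !natrD ?natrB//.
  by field; lra.
by rewrite ler_pdivrMr; lra.
Qed.

(** Euclid's algorithm: one step, if a <= b, or two steps, if b < a, decrease a + b,
until one of the two is zero. *)
Lemma rational_hits1 (a b : nat) : (0 < a + b)%N ->
  exists m, iter m F (b%:R / (a + b)%:R) = 1.
Proof.
have [n] := ubnP (a + b); elim: n a b => [//|n IH] a b abn ab0.
case: a abn ab0 => [|a] abn ab0.
  by exists 0%N; rewrite /= divff// pnatr_eq0 -lt0n.
case: b abn ab0 => [|b] abn ab0.
  by exists 2%N; rewrite /= mul0r F0 F_half.
have [ab|ba] := leqP a.+1 b.+1.
  have [|//|m mE] := IH (b.+1 - a.+1)%N a.+1; first by rewrite subnK//; lia.
  by rewrite addnS.
  by exists m.+1; rewrite iterSr F_frac_le.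
have [||m mE] := IH b.+1 (a.+1 - b.+1)%N; try by rewrite subnKC; lia.
exists m.+2; rewrite !iterSr F_frac_ge//; last by lia.
by rewrite F_frac_le ?subn_gt0//; [rewrite subKn//; lia |  lia..].
Qed.

(** For u = 1 - t the branch of the inverse of the third iterate that fixes 1 is
u -> u/(1+2u), that is 1/u -> 1/u + 2; after j applications, u <= 1 has become
at most 1/(2j+1). *)
Lemma F3_cover j s : 0 <= s <= 1 ->
  exists t, [/\ 0 <= t <= 1, 1 - t <= 1 / (2 * j + 1)%:R & iter (3 * j) F t = s].
Proof.
move=> s01; elim: j => [|j [t [t01 tj tE]]].
  by exists s; split=> //; rewrite muln0 add0n; lra.
exists (psi0 (psi1 (psi0 t))).
have p0 := psi0_itv t01.
have p1 := psi1_itv p0.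
have p1' : 0 <= psi1 (psi0 t) <= 1 by lra.
have p2 := psi0_itv p1'.
split.
- lra.
- have -> : psi0 (psi1 (psi0 t)) = (2 - t) / (3 - 2 * t).
    by rewrite /psi0 /psi1; field; lra.
  pose m : R := (2 * j + 1)%:R; rewrite -/m in tj.
  have m0 : 0 < m by rewrite ltr0n addn1.
  have -> : (2 * j.+1 + 1)%:R = m + 2.
    by rewrite /m -natrD mulnS -addnA addnC.
  rewrite ler_pdivlMr; last by lra.
  have -> : 1 - (2 - t) / (3 - 2 * t) = (1 - t) / (3 - 2 * t).
    by field; lra.
  rewrite mulrAC ler_pdivrMr; last by lra.
  move: tj; rewrite ler_pdivlMr// => tj; nra.
- rewrite mulnS addnC iterD /= F_psi0// F_psi1// F_psi0//.
Qed.

End interval_map.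

(** * One-sided germs, exactness and periodic points *)

Section expansion.
Context {R : realType}.
Implicit Types (s t u x y : R) (n k j m : nat) (b : bool).

Definition side b t x := if b then t <= x else x <= t.

(** An iterate of F may fold a neighbourhood of t, but each of the two
one-sided neighbourhoods is mapped injectively to one side of the image.
Recording that side is what makes the induction on k go through, although t
may return to the turning point many times. *)
Lemma one_sided_germ k t b : 0 <= t <= 1 -> exists2 e, 0 < e &
  let D := [set x | [/\ 0 <= x <= 1, `|x - t| < e & side b t x]] in
  (exists b', forall x, D x -> side b' (iter k F t) (iter k F x)) /\
  (forall x y, D x -> D y -> iter k F x = iter k F y -> x = y).
Proof.
elim: k t b => [|k IH] t b t01.
  by exists 1 => //; split=> //; exists b => x [].
have [e1 e10 [b1 b1P Finj]] : exists2 e, 0 < e &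
    exists2 b', (forall x, 0 <= x <= 1 -> `|x - t| < e -> side b t x ->
      side b' (F t) (F x)) &
    (forall x y, 0 <= x <= 1 -> `|x - t| < e -> side b t x ->
     0 <= y <= 1 -> `|y - t| < e -> side b t y -> F x = F y -> x = y).
  case: b; rewrite /side.
    case: (ltP t (1/2)) => th.
      exists (1/2 - t); first by lra.
      have H x : 0 <= x <= 1 -> `|x - t| < 1/2 - t -> t <= x -> 0 <= x <= 1/2.
        by rewrite ltr_norml; lra.
      exists true => [x x01 xt tx|x y x01 xt tx y01 yt ty].
        have hx := H x x01 xt tx.
        by apply: F_incr; lra.
      by apply: F_inj_left; exact: H.
    exists 1 => //; exists false => [x x01 xt tx|x y x01 xt tx y01 yt ty].
      by apply: F_decr; lra.
    by apply: F_inj_right; lra.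
  case: (leP t (1/2)) => th.
    exists 1 => //; exists false => [x x01 xt tx|x y x01 xt tx y01 yt ty].
      by apply: F_incr; lra.
    by apply: F_inj_left; lra.
  exists (t - 1/2); first by lra.
  have H x : 0 <= x <= 1 -> `|x - t| < t - 1/2 -> x <= t -> 1/2 <= x <= 1.
    by rewrite ltr_norml; lra.
  exists true => [x x01 xt tx|x y x01 xt tx y01 yt ty].
    have hx := H x x01 xt tx.
    by apply: F_decr; lra.
  by apply: F_inj_right; exact: H.
have Ft01 := iterF_itv 1 t01.
have [e2 e20 [[b2 b2P] kinj]] := IH (F t) b1 Ft01.
have [e3 /= e30 e3P] : exists2 e : R, 0 < e &
    forall x, `|x - t| < e -> `|F x - F t| < e2.
  have /cvgrPdist_lt /(_ _ e20) := @F_continuous R t.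
  by move=> /nbhs_ballP[e /= e0 eP]; exists e => // x xt; rewrite distrC;
    apply: eP; rewrite /ball /= distrC.
have lt1 x : `|x - t| < Num.min e1 e3 -> `|x - t| < e1.
  by rewrite lt_min => /andP[].
have lt3 x : `|x - t| < Num.min e1 e3 -> `|x - t| < e3.
  by rewrite lt_min => /andP[].
exists (Num.min e1 e3); first by rewrite lt_min e10.
split.
  exists b2 => x [x01 xt xs]; rewrite -!iterS !iterSr; apply: b2P; split.
  - exact: (iterF_itv 1 x01).
  - exact/e3P/lt3.
  - by apply: b1P => //; exact: lt1.
move=> x y [x01 xt xs] [y01 yt ys]; rewrite -!iterS !iterSr => exy.
apply: Finj => //; try exact: lt1.
apply: kinj exy; split.
- exact: (iterF_itv 1 x01).
- exact/e3P/lt3.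
- by apply: b1P => //; exact: lt1.
- exact: (iterF_itv 1 y01).
- exact/e3P/lt3.
- by apply: b1P => //; exact: lt1.
Qed.

Lemma rat_hits1 (q : rat) : 0 <= (ratr q : R) <= 1 ->
  exists m, iter m F (ratr q) = 1 :> R.
Proof.
move=> /andP[q0 q1]; rewrite ler0q in q0.
rewrite -(rmorph1 (@ratr R)) ler_rat in q1.
have [n nE] : exists n : nat, numq q = n.
  by exists `|numq q|%N; rewrite gez0_abs// numq_ge0.
have [d dE] : exists d : nat, denq q = d.
  by exists `|denq q|%N; rewrite gez0_abs// ltW// denq_gt0.
have d0 : (0 < d)%N by have := denq_gt0 q; rewrite dE.
have nd : (n <= d)%N.
  move: q1; rewrite -{1}(divq_num_den q) nE dE ler_pdivrMr ?ltr0n//.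
  by rewrite mul1r ler_nat.
have := @rational_hits1 R (d - n) n; rewrite subnK// => /(_ d0).
by rewrite /ratr nE dE.
Qed.

Lemma iterF_surj n s : 0 <= s <= 1 -> exists2 t, 0 <= t <= 1 & iter n F t = s.
Proof.
elim: n s => [|n IH] s s01; first by exists s.
have p := psi0_itv s01.
have [|t t01 tE] := IH (psi0 s); first by lra.
by exists t => //; rewrite /= tE F_psi0.
Qed.

(** A rational t of ]a,b[ is mapped to 1 by some iterate, and one-sided
injectivity at t shows that this iterate is not constant on [t,b]; so its
image contains some [1-d,1], to which F3_cover applies. *)
Lemma iterF_exact (a b : R) : 0 <= a -> a < b -> b <= 1 ->
  exists N, forall n, (N <= n)%N ->
  forall s, 0 <= s <= 1 -> exists2 t, a <= t <= b & iter n F t = s.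
Proof.
move=> a0 ab b1.
have [q] := rat_in_itvoo ab; rewrite in_itv/= => /andP[aq qb].
set t : R := ratr q in aq qb *.
have [|m mE] := @rat_hits1 q; first by rewrite -/t; lra.
have [|e e0 [_ inj]] := @one_sided_germ m t true; first by lra.
pose x := Num.min (t + e / 2) b.
have tx : t < x by rewrite lt_min qb andbT; lra.
have xb : x <= b by rewrite ge_min lexx orbT.
have xe : x <= t + e / 2 by rewrite ge_min lexx.
have x1 : iter m F x < 1.
  have /andP[_ le1] : 0 <= iter m F x <= 1 by apply: iterF_itv; lra.
  rewrite lt_neqAle le1 andbT; apply/negP => /eqP; rewrite -mE => /inj e1.
  suff : x = t by lra.
  by apply: e1; split; rewrite /side ?ltr_norml; lra.
have d0 : 0 < 1 - iter m F x by lra.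
have [j jP] : exists j : nat, 1 / (2 * j + 1)%:R <= 1 - iter m F x.
  exists (Num.truncn (1 - iter m F x)^-1).
  set d := 1 - _ in d0 *; set j := Num.truncn _.
  have dj : d^-1 < j.+1%:R by apply: truncnS_gt; rewrite invr_ge0 ltW.
  rewrite ler_pdivrMr ?ltr0n ?addn1// mulrC -ler_pdivrMr// div1r.
  by apply: le_trans (ltW dj) _; rewrite ler_nat ltnS leq_pmull.
exists (3 * j + m)%N => n nN s s01.
have [s' s'01 s'E] := iterF_surj (n - (3 * j + m)) s01.
have [u [u01 uj uE]] := F3_cover j s'01.
have [||v] := @IVT R (iter m F) t x u (ltW tx).
- by apply: continuous_subspaceT; exact: iterF_continuous.
- by rewrite mE ge_min le_max; apply/andP; split; apply/orP; [right|left]; lra.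
rewrite in_itv/= => /andP[tv vx] vE; exists v; first by lra.
by rewrite -(subnK nN) iterD iterD vE uE s'E.
Qed.

(** An iterate maps [a,b] onto [0,1], so it sends some u in [a,b] to a and some v
to b; its graph crosses the diagonal between u and v. *)
Lemma periodic_in_itv (a b : R) : 0 <= a -> a < b -> b <= 1 ->
  exists t n, [/\ a <= t <= b, (0 < n)%N & iter n F t = t].
Proof.
move=> a0 ab b1; have [N NP] := iterF_exact a0 ab b1.
(* The exponent N+1 rather than N makes the period positive. *)
have [|u uab uE] := NP N.+1 (leqnSn _) a; first by lra.
have [|v vab vE] := NP N.+1 (leqnSn _) b; first by lra.
pose g x := iter N.+1 F x - x.
have gc : continuous g.
  by move=> x; apply: cvgB; [exact: iterF_continuous | exact: cvg_id].
suff [c cab c0] : exists2 c, a <= c <= b & g c = 0.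
  by exists c, N.+1; split=> //; apply/eqP; rewrite -subr_eq0 -/(g c) c0.
have gu : g u <= 0 by rewrite /g uE; lra.
have gv : 0 <= g v by rewrite /g vE; lra.
have [uv|vu] := leP u v.
  have [||c] := @IVT R g u v 0 uv.
  - exact: continuous_subspaceT.
  - by rewrite ge_min le_max gu gv orbT.
  by rewrite in_itv/= => cuv c0; exists c => //; lra.
have [||c] := @IVT R g v u 0 (ltW vu).
- exact: continuous_subspaceT.
- by rewrite ge_min le_max gu gv orbT.
by rewrite in_itv/= => cuv c0; exists c => //; lra.
Qed.

Lemma orbit1 n : iter n F (1 : R) \in [:: 0; 1/2; 1].
Proof.
elim: n => [|n]; first by rewrite !inE eqxx !orbT.
by rewrite /= !inE => /or3P[] /eqP ->; rewrite ?F0 ?F_half ?F1 eqxx ?orbT.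
Qed.

Lemma periodic_rational t n : (0 < n)%N -> iter n F t = t -> 0 <= t <= 1 ->
  rational t -> t \in [:: 0; 1/2; 1].
Proof.
move=> n0 nt t01 [q _ qt]; have [|m] := @rat_hits1 q; first by rewrite qt.
rewrite qt => mE.
(* t is its own iterate of order m n >= m, which lies on the orbit of 1. *)
have per k : iter (k * n) F t = t by elim: k => // k IH; rewrite mulSn iterD IH.
have mn : (m <= m * n)%N by rewrite leq_pmulr.
by rewrite -(per m) -(subnK mn) iterD mE; exact: orbit1.
Qed.

End expansion.

(** * Counting preimages *)

Section counting.
Context {R : realType}.
Implicit Types (s t x y : R) (S B : seq R) (n : nat).

(** The points x and y lie in the same cell of the partition of the line by S,
where the cells are the points of S and the open gaps between them. *)
Definition inseparable S x y : Prop :=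
  forall s, s \in S -> (s <= x) = (s <= y) /\ (x <= s) = (y <= s).

(** This is the number of the cell of x.  Weak and strict inequalities are both
counted because the points of S are cells too. *)
Definition position S x :=
  (count (fun s => (s <= x)%R) S + count (fun s => (s < x)%R) S)%N.

Lemma position_lt S x : (position S x < (2 * size S).+1)%N.
Proof. by rewrite ltnS mul2n -addnn leq_add// count_size. Qed.

Lemma count_eq_in (a b : pred R) S : subpred a b -> count a S = count b S ->
  forall s, s \in S -> a s = b s.
Proof.
move=> ab; elim: S => //= r S IH e s.
have h1 := sub_count ab S.
have h2 : (a r <= b r)%N by case: (a r) (ab r) => // ->.
have er : a r = b r :> nat by lia.
have eS : count a S = count b S by lia.
rewrite inE => /orP[/eqP ->|]; last exact: IH.
by move: er; case: (a r); case: (b r).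
Qed.

Lemma position_inj S x y : position S x = position S y -> inseparable S x y.
Proof.
wlog xy : x y / x <= y.
  move=> H e; have [xy|/ltW yx] := leP x y; first exact: H.
  by move=> s sS; have [-> ->] := H y x yx (esym e) s sS.
have sub1 : subpred (fun s => s <= x) (fun s => s <= y).
  by move=> s /= sx; apply: le_trans xy.
have sub2 : subpred (fun s => s < x) (fun s => s < y).
  by move=> s /= sx; apply: lt_le_trans xy.
rewrite /position => e s sS.
have h1 := sub_count sub1 S; have h2 := sub_count sub2 S.
split; first by apply: (count_eq_in sub1 _ sS); lia.
rewrite !leNgt; congr (~~ _).
by apply: (count_eq_in sub2 _ sS); lia.
Qed.

(** The list of the preimages of s in [0,1].  For s = 1 the two branches meet at
1/2, which must be listed only once. *)
Definition branches s := psi0 s ::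
  (if (1/2 <= s) && (s < 1) then [:: psi1 s] else [::]).

Definition preimages S := flatten [seq branches s | s <- S].

Lemma branchesP s y : 0 <= s <= 1 -> y \in branches s -> 0 <= y <= 1 /\ F y = s.
Proof.
move=> s01; rewrite inE => /orP[/eqP ->|].
  by rewrite F_psi0//; split=> //; have := psi0_itv s01; lra.
case: ifP => // sh; rewrite inE => /eqP ->.
have h : 1/2 <= s <= 1 by lra.
by rewrite F_psi1//; split=> //; have := psi1_itv h; lra.
Qed.

Lemma preimages_itv S : {in S, forall s, 0 <= s <= 1} ->
  {in preimages S, forall s, 0 <= s <= 1}.
Proof.
move=> H y /flattenP[_ /mapP[s sS ->]] yb.
by case: (branchesP (H s sS) yb).
Qed.

(** Once 1/2 is a division point, x and y lie on the same half of [0,1], where F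
is monotone, so comparing F x with s amounts to comparing x with a preimage
of s. *)
Lemma inseparable_F S x y : {in S, forall s, 0 <= s <= 1} ->
  0 <= x <= 1 -> 0 <= y <= 1 ->
  inseparable (1/2 :: preimages S) x y -> inseparable S (F x) (F y).
Proof.
move=> S01 x01 y01 H s sS; have s01 := S01 s sS.
have [hx hy] := H (1/2) (mem_head _ _).
have pre r : r \in branches s -> (r <= x) = (r <= y) /\ (x <= r) = (y <= r).
  move=> rb; apply: H; rewrite inE; apply/orP; right.
  by apply/flattenP; exists (branches s) => //; apply/mapP; exists s.
have [x2|x2] := leP (1/2) x.
  have y2 : 1/2 <= y by rewrite -hx.
  have [e1 e2] := pre (psi0 s) (mem_head _ _).
  have s0 : 0 <= s by lra.
  by rewrite !F_le_right// !F_ge_right.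
have y2 : y < 1/2 by rewrite ltNge -hx -ltNge.
have [s2|s2] := leP (1/2) s; last first.
  have Fx : 1/2 <= F x by apply: F_left_ge; lra.
  have Fy : 1/2 <= F y by apply: F_left_ge; lra.
  by lra.
rewrite !F_le_left ?(ltW x2) ?(ltW y2)// !F_ge_left ?(ltW x2) ?(ltW y2)//.
have [s1|s1] := ltP s 1; last first.
  have -> : s = 1 by lra.
  have -> : psi1 (1 : R) = 1/2 by rewrite /psi1 !mulr1; congr (_ / _); lra.
  by lra.
have [|e1 e2] := pre (psi1 s); last by [].
by rewrite inE s2 s1 mem_head orbT.
Qed.

(** The points of B together with all their preimages of order at most n. *)
Definition refinement B n := iter n (fun S => B ++ preimages S) B.

Lemma refinement_itv B n : {in B, forall s, 0 <= s <= 1} ->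
  {in refinement B n, forall s, 0 <= s <= 1}.
Proof.
move=> H; elim: n => // n IH s.
by rewrite /= mem_cat => /orP[/H //|]; exact: preimages_itv.
Qed.

Lemma inseparable_iter B n x y : {in B, forall s, 0 <= s <= 1} -> 1/2 \in B ->
  0 <= x <= 1 -> 0 <= y <= 1 -> inseparable (refinement B n) x y ->
  forall i, (i <= n)%N -> inseparable B (iter i F x) (iter i F y).
Proof.
move=> B01 hB; elim: n x y => [|n IH] x y x01 y01 H i.
  by rewrite leqn0 => /eqP ->.
case: i => [_|i].
  by move=> s sB; apply: H; rewrite /= mem_cat sB.
rewrite ltnS !iterSr; apply: IH; try exact: (iterF_itv 1).
apply: inseparable_F => //; first exact: refinement_itv.
move=> s; rewrite inE => /orP[/eqP ->|sp]; apply: H.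
  by rewrite /= mem_cat hB.
by rewrite /= mem_cat sp orbT.
Qed.

Lemma grid (e : R) : 0 < e ->
  exists B, [/\ {in B, forall s, 0 <= s <= 1}, 1/2 \in B &
  forall x y, 0 <= x <= 1 -> 0 <= y <= 1 -> inseparable B x y -> `|x - y| < e].
Proof.
move=> e0; pose M := (Num.truncn e^-1).+1.
have Me : e^-1 < M%:R by exact: truncnS_gt.
have M0 : 0 < M%:R :> R by rewrite ltr0n.
have eM : 1 < M%:R * e by rewrite -ltr_pdivrMr// div1r.
pose d : R := (2 * M)%:R.
have dE : d = 2 * M%:R by rewrite /d natrM.
have d0 : 0 < d by lra.
(* An even number of steps makes 1/2 a grid point. *)
exists [seq i%:R / d | i <- iota 0 (2 * M).+1]; split.
- move=> s /mapP[i]; rewrite mem_iota add0n ltnS => /andP[_ iM] ->.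
  rewrite divr_ge0 ?(ltW d0)//= ler_pdivrMr// mul1r /d ler_nat; exact: iM.
- apply/mapP; exists M; first by rewrite mem_iota add0n ltnS leq_pmull.
  by rewrite dE; field; rewrite gt_eqF.
move=> x y; wlog xy : x y / x <= y.
  move=> H x01 y01 I; have [xy|/ltW yx] := leP x y; first exact: H.
  by rewrite distrC; apply: H => // s sB; have [-> ->] := I s sB.
move=> x01 y01 I; rewrite distrC ger0_norm; last by lra.
pose i := Num.truncn (x * d).
have xd : 0 <= x * d by apply: mulr_ge0; lra.
have i1 : i%:R <= x * d by rewrite truncn_le.
have i2 : x * d < i.+1%:R by exact: truncnS_gt.
have [iM|Mi] := ltnP i (2 * M); last first.
  have : d <= i%:R by rewrite ler_nat.
  move=> di; have : 1 <= x by rewrite -(ler_pM2r d0); lra.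
  by lra.
have [|e1 _] := I (i.+1%:R / d).
  by apply/mapP; exists i.+1 => //; rewrite mem_iota add0n ltnS.
have xs : x < i.+1%:R / d by rewrite ltr_pdivlMr.
have ys : y < i.+1%:R / d by rewrite ltNge -e1 -ltNge.
rewrite ltr_pdivlMr// -natr1 in ys.
by rewrite -(ltr_pM2r d0); lra.
Qed.

Variable lambda : R.
Hypothesis lambda_gt1 : 1 < lambda.
Hypothesis lambdaE : lambda ^+ 2 = lambda + 1.

(** A left eigenvector of the transition matrix: the two preimages of a point
of the right half [1/2,1[ lie one on each side and have total weight
lambda + 1 = lambda * lambda, the only preimage of a point of the left half
lies on the right and has weight lambda. *)
Definition weight t := if 1/2 <= t then lambda else 1.
Definition mass S := \sum_(t <- S) weight t.

Lemma weight_ge1 t : 1 <= weight t.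
Proof. by rewrite /weight; case: ifP => _ //; exact: ltW. Qed.

Lemma weight_le t : weight t <= lambda.
Proof. by rewrite /weight; case: ifP => _ //; exact: ltW. Qed.

Lemma size_le_mass S : (size S)%:R <= mass S.
Proof.
rewrite -sum1_size natr_sum; apply: ler_sum => t _; exact: weight_ge1.
Qed.

Lemma mass_le_size S : mass S <= lambda * (size S)%:R.
Proof.
rewrite -sum1_size natr_sum mulr_sumr; apply: ler_sum => t _.
by rewrite mulr1; exact: weight_le.
Qed.

(** The point 1 is exceptional since its two preimages coincide. *)
Lemma mass_branches s : 0 <= s <= 1 ->
  mass (branches s) = lambda * weight s - (if s == 1 then 1 else 0).
Proof.
move=> s01; have p0 := psi0_itv s01; have le2 := lambdaE; rewrite expr2 in le2.
rewrite /mass big_cons {1}/weight; case/andP: p0 => -> _.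
case: ifP => sh; last first.
  rewrite big_nil /weight; case: eqP => [s1|s1]; last by rewrite ifF; lra.
  by rewrite ifT; lra.
rewrite big_seq1 /weight; case/andP: (sh) => -> s1.
rewrite ifF; last by have := psi1_lt sh; lra.
by rewrite lt_eqF//; lra.
Qed.

Lemma mass_cat S B : mass (S ++ B) = mass S + mass B.
Proof. exact: big_cat. Qed.

Lemma mass_preimages S : mass (preimages S) = \sum_(s <- S) mass (branches s).
Proof. by rewrite /mass /preimages big_flatten big_map. Qed.

Lemma mass_preimages_le S : {in S, forall s, 0 <= s <= 1} ->
  mass (preimages S) <= lambda * mass S.
Proof.
move=> S01; rewrite mass_preimages /mass mulr_sumr big_seq [X in _ <= X]big_seq.
apply: ler_sum => s /S01 s01; rewrite -/(mass _) mass_branches//.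
by case: ifP => _; lra.
Qed.

Lemma mass_preimages_eq S : {in S, forall s, 0 <= s < 1} ->
  mass (preimages S) = lambda * mass S.
Proof.
move=> S01; rewrite mass_preimages /mass mulr_sumr big_seq [RHS]big_seq.
apply: eq_bigr => s /S01 s01; rewrite -/(mass _) mass_branches; last by lra.
by rewrite lt_eqF ?subr0//; lra.
Qed.

(** The recursion M (n+1) <= M 0 + lambda M n becomes geometric after adding the
constant M 0 / (lambda - 1). *)
Lemma mass_refinement B n : {in B, forall s, 0 <= s <= 1} ->
  mass (refinement B n) + mass B / (lambda - 1) <=
  (mass B + mass B / (lambda - 1)) * lambda ^+ n.
Proof.
move=> B01; elim: n => [|n IH]; first by rewrite expr0 mulr1.
have h := mass_preimages_le (@refinement_itv B n B01).
rewrite [refinement B n.+1]/= -/(refinement B n) mass_cat exprS.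
set c := mass B / (lambda - 1) in IH *.
have cE : mass B + c = lambda * c by rewrite /c; field; rewrite gt_eqF// subr_gt0.
clearbody c.
rewrite [_ * (lambda * _)]mulrCA.
apply: (@le_trans _ _ (lambda * (mass (refinement B n) + c))).
  by rewrite mulrDr -cE [mass B + _]addrC -addrA lerD2r.
by rewrite ler_pM2l ?IH// (lt_trans ltr01).
Qed.

(** In the coordinate t the point x = 1/2 is 2/3; it is chosen because the cycle
of the turning point avoids it. *)
Definition preorbit n := iter n preimages [:: 2/3 : R].

Lemma preorbitP n y : y \in preorbit n -> 0 <= y <= 1 /\ iter n F y = 2/3.
Proof.
elim: n y => [|n IH] y.
  by rewrite inE => /eqP ->; split=> //; lra.
move=> /flattenP[_ /mapP[s /IH[s01 sE] ->]] /(branchesP s01)[y01 yE].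
by rewrite iterSr yE.
Qed.

(** The orbit of 1 stays in {0,1/2,1} and never reaches 2/3, so no preimage is
lost by coincidence of the two branches. *)
Lemma preorbit_lt1 n : {in preorbit n, forall s, 0 <= s < 1}.
Proof.
move=> s /preorbitP[s01 sE].
suff : s != 1 by rewrite lt_neqAle => ->; case/andP: s01 => -> ->.
apply/negP => /eqP s1; rewrite s1 in sE; have := @orbit1 R n; rewrite sE !inE.
by move=> /or3P[] /eqP; lra.
Qed.

Lemma branches_uniq s : 0 <= s <= 1 -> uniq (branches s).
Proof.
move=> s01; have p0 := psi0_itv s01; rewrite /branches; case: ifP => // sh.
rewrite cons_uniq mem_seq1 andbT gt_eqF//.
by have := psi1_lt sh; lra.
Qed.

Lemma preimages_uniq S : {in S, forall s, 0 <= s <= 1} -> uniq S ->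
  uniq (preimages S).
Proof.
elim: S => // s S IH S01; rewrite cons_uniq => /andP[sS uS].
have s01 : 0 <= s <= 1 by apply: S01; exact: mem_head.
have S01' : {in S, forall r, 0 <= r <= 1}.
  by move=> r rS; apply: S01; rewrite inE rS orbT.
rewrite -[preimages _]/(branches s ++ preimages S) cat_uniq branches_uniq//.
rewrite IH// andbT; apply/hasPn => y yS; apply/negP => /(branchesP s01)[_ ys].
move: yS => /flattenP[_ /mapP[r rS ->]] /(branchesP (S01' r rS))[_ yr].
by move: sS; rewrite -ys yr rS.
Qed.

Lemma preorbit_uniq n : uniq (preorbit n).
Proof.
elim: n => // n IH; apply: preimages_uniq => // s /preorbit_lt1 /andP[-> s1].
exact: ltW.
Qed.

Lemma mass_preorbit n : mass (preorbit n) = lambda ^+ n.+1.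
Proof.
elim: n => [|n IH].
  by rewrite /mass big_seq1 /weight ifT ?expr1//; lra.
by rewrite /= mass_preimages_eq ?IH -?exprS//; exact: preorbit_lt1.
Qed.

Lemma size_preorbit n : lambda ^+ n <= (size (preorbit n))%:R.
Proof.
have := mass_le_size (preorbit n).
by rewrite mass_preorbit exprS ler_pM2l// (lt_trans ltr01).
Qed.

End counting.

(** * Transfer to the extended half-line *)

Section coordinate.
Context {R : realType}.
Notation X := (set_type (@ext_halfline R)).
Implicit Types (x y : X) (t s : R).

(** The coordinate 1/(1+x) on [0,oo]. *)
Definition theta x : R := if set_val x is r%:E then (1 + r)^-1 else 0.

Lemma halfline_ind (P : X -> Prop) :
  (forall x (r : R), 0 <= r -> set_val x = r%:E -> P x) ->
  (forall x, set_val x = +oo%E -> P x) -> forall x, P x.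
Proof.
move=> Pr Poo x; case xE : (set_val x) => [r| |].
- apply: (Pr _ r) => //; have : ext_halfline (set_val x) := set_valP x.
  by rewrite xE /ext_halfline /= lee_fin.
- exact: Poo.
- by have : ext_halfline (set_val x) := set_valP x; rewrite xE /ext_halfline /=.
Qed.

Lemma theta_itv x : 0 <= theta x <= 1.
Proof.
rewrite /theta; elim/halfline_ind : x => [x r r0|x] ->; last by lra.
by rewrite invr_ge0 invf_le1; lra.
Qed.

Lemma chi_subproof t :
  (if 0 < t <= 1 then (t^-1 - 1)%:E else +oo%E) \in @ext_halfline R.
Proof.
rewrite inE /ext_halfline /=; case: ifP => // /andP[t0 t1].
by rewrite lee_fin subr_ge0 invf_ge1.
Qed.

Definition chi t : X :=
  exist (fun z => z \in @ext_halfline R) _ (chi_subproof t).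

Lemma chi_val t :
  set_val (chi t) = if 0 < t <= 1 then (t^-1 - 1)%:E else +oo%E.
Proof. by rewrite set_valE. Qed.

Lemma phi_val x : set_val (phi x) = phi_ereal (set_val x).
Proof. by rewrite [in LHS]set_valE. Qed.

Lemma inj_halfline x y : set_val x = set_val y -> x = y.
Proof. by rewrite set_valE; exact: val_inj. Qed.

Lemma chiK t : 0 <= t <= 1 -> theta (chi t) = t.
Proof.
move=> t01; rewrite /theta chi_val; have [t0|t0] := ltP 0 t => /=; last by lra.
rewrite ifT; last by lra.
by rewrite addrC subrK invrK.
Qed.

Lemma thetaK x : chi (theta x) = x.
Proof.
apply: (@inj_halfline); rewrite chi_val /theta.
elim/halfline_ind : x => [x r r0|x] xE; rewrite xE.
  rewrite ifT; last by rewrite invr_gt0 invf_le1; lra.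
  by rewrite invrK addrC addKr.
by rewrite ltxx.
Qed.

Lemma theta_inj : injective theta.
Proof. exact: can_inj thetaK. Qed.

Lemma theta_phi x : theta (phi x) = F (theta x).
Proof.
rewrite /theta; elim/halfline_ind : x => [x r r0|x] xE; rewrite phi_val xE /=.
  have [r00|rn0] := eqVneq r 0; first by rewrite r00 addr0 invr1 F1.
  have rp : 0 < r by rewrite lt_neqAle eq_sym rn0.
  have [r1|r1] := leP r 1.
    rewrite F_right; last by rewrite -[X in _ <= X]div1r ler_pdivlMr; lra.
    rewrite ler0_norm; first by field; lra.
    by rewrite subr_le0 invf_ge1; lra.
  rewrite F_left; last by rewrite -[X in X <= _]div1r ler_pdivrMr; lra.
  rewrite ger0_norm; last by rewrite subr_ge0 invf_le1; lra.
  by field; lra.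
by rewrite F0 div1r.
Qed.

Lemma theta_iter n x : theta (iter n (@phi R) x) = iter n F (theta x).
Proof. by elim: n => //= n IH; rewrite theta_phi IH. Qed.

(** Together with the continuity of theta this says that theta is a homeomorphism
onto [0,1]. *)
Lemma nbhs_theta x (A : set X) : nbhs x A ->
  exists2 e, 0 < e & forall y, `|theta y - theta x| < e -> A y.
Proof.
move=> [_ [[B oB <-] /= Bx] BA].
have nB : nbhs (set_val x) B by apply: open_nbhs_nbhs.
suff [e e0 eB] : exists2 e, 0 < e &
    forall y, `|theta y - theta x| < e -> B (set_val y).
  by exists e => // y /eB; exact: BA.
move: nB; elim/halfline_ind : x {BA Bx} => [x r r0|x] xE; rewrite xE; last first.
  case=> M [_ MB]; exists (1 + `|M|)^-1; first by rewrite invr_gt0 ltr_wpDr.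
  move=> y; rewrite /theta xE subr0 => h; apply: MB; move: h.
  elim/halfline_ind : y => [y s s0|y] -> //; last by rewrite ltry.
  have M1 : 0 < 1 + `|M| by rewrite ltr_wpDr.
  have s1 : 0 < 1 + s by rewrite ltr_wpDr.
  rewrite gtr0_norm ?invr_gt0// ltf_pV2// ltrD2l.
  by rewrite lte_fin; apply: le_lt_trans; exact: ler_norm.
move=> nB; have /nbhs_ballP[d /= d0 dB] : nbhs r (fun s : R => B s%:E) := nB.
have c0 : 0 < (1 + r)^-1 by rewrite invr_gt0; lra.
have /cvgrPdist_lt /(_ _ d0) : (fun t : R => t^-1) @ (1 + r)^-1 --> (1 + r)^-1^-1.
  by apply: cvgV; [rewrite gt_eqF | exact: cvg_id].
move=> /nbhs_ballP[e /= e0 eP].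
exists (Num.min e (1 + r)^-1); first by rewrite lt_min e0.
move=> y; rewrite /theta xE lt_min => /andP[].
elim/halfline_ind : y => [y s s0|y] ->.
  move=> h1 _; apply: dB; rewrite /ball /=.
  have := eP (1 + s)^-1; rewrite /ball /= distrC => /(_ h1); rewrite !invrK.
  by rewrite opprD addrACA subrr add0r.
by rewrite sub0r normrN gtr0_norm// ltxx.
Qed.

Lemma theta_continuous : continuous theta.
Proof.
move=> x; have FF : Filter (nbhs (x : X)) := nbhs_filter x.
apply/(@cvgrPdist_lt _ _ _ _ FF) => e e0.
suff : \forall z \near set_val x,
    forall y, set_val y = z -> `|theta x - theta y| < e.
  have ic : set_val @ x --> set_val x :=
    @initial_continuous _ _ (@set_val _ (@ext_halfline R)) x.
  move=> /ic h; apply: (@filterS _ (nbhs (x : X)) _ _ _ _ h) => y /=.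
  exact.
elim/halfline_ind : x {FF} => [x r r0|x] xE; rewrite xE /theta xE.
  have c0 : 0 < (1 + r)^-1 by rewrite invr_gt0; lra.
  have : (fun s : R => (1 + s)^-1) @ r --> (1 + r)^-1.
    apply: cvgV; first by rewrite gt_eqF//; lra.
    by apply: cvgD; [exact: cvg_cst | exact: cvg_id].
  move=> /cvgrPdist_lt /(_ _ e0); rewrite /=.
  by move=> h; apply: filterS h => s h y ->.
exists e^-1; split; first exact: num_real.
case=> [s| |] //= h y yE; rewrite yE ?subrr ?normr0//.
rewrite lte_fin in h; have ep : 0 < e^-1 by rewrite invr_gt0.
rewrite sub0r normrN gtr0_norm; last by rewrite invr_gt0; lra.
by rewrite -[e]invrK ltf_pV2 ?posrE; lra.
Qed.

Lemma phi_continuous : continuous (@phi R).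
Proof.
move=> x A /nbhs_theta[e e0 eA].
have : continuous (F \o theta).
  move=> z; apply: continuous_comp; first exact: theta_continuous.
  exact: F_continuous.
move=> /(_ x) /cvgrPdist_lt /(_ _ e0); apply: filterS => y h.
by apply: eA; rewrite !theta_phi distrC.
Qed.

Lemma open_theta_ball t e : open [set x | `|theta x - t| < e].
Proof.
have -> : [set x | `|theta x - t| < e] = theta @^-1` (ball t e).
  by apply/seteqP; split=> x /=; rewrite /ball /= distrC.
by apply: open_comp => [x _|]; [exact: theta_continuous | exact: ball_open].
Qed.

(** The interval is chosen inside ]0,1[ and off the turning point, so that it
misses the cycle {0,1/2,1} of rational periodic points. *)
Lemma open_itv (A : set X) : open A -> A !=set0 -> exists a b : R,
  [/\ 0 < a, a < b, b < 1, (forall t, a <= t <= b -> t != 1/2) &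
    forall t, a <= t <= b -> A (chi t)].
Proof.
move=> oA [x Ax]; have [e e0 eA] := nbhs_theta (open_nbhs_nbhs (conj oA Ax)).
have xA t : 0 <= t <= 1 -> `|t - theta x| < e -> A (chi t).
  by move=> t01 te; apply: eA; rewrite chiK.
have H (l u : R) : 0 <= l -> l < u -> u <= 1 -> (u <= 1/2) || (1/2 <= l) ->
    theta x - e <= l -> u <= theta x + e -> exists a b : R,
  [/\ 0 < a, a < b, b < 1, (forall t, a <= t <= b -> t != 1/2) &
    forall t, a <= t <= b -> A (chi t)].
  move=> l0 lu u1 h le ue; exists ((2 * l + u) / 3), ((l + 2 * u) / 3).
  split; try lra.
    by move=> t th; case/orP: h => h; [rewrite lt_eqF | rewrite gt_eqF]; lra.
  by move=> t th; apply: xA; rewrite ?ltr_norml; lra.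
have x01 := theta_itv x.
have [xh|xh] := ltP (theta x) (1/2).
  have m1 : Num.min (theta x + e) (1/2) <= 1/2 by rewrite ge_min lexx orbT.
  apply: (H (theta x) (Num.min (theta x + e) (1/2))); try lra.
  - by rewrite lt_min xh andbT; lra.
  - by rewrite ge_min lexx.
have [x1|x1] := ltP (theta x) 1.
  have m1 : Num.min (theta x + e) 1 <= 1 by rewrite ge_min lexx orbT.
  apply: (H (theta x) (Num.min (theta x + e) 1)); try lra.
  - by rewrite lt_min x1 andbT; lra.
  - by rewrite ge_min lexx.
have m1 : 1/2 <= Num.max (theta x - e) (1/2) by rewrite le_max lexx orbT.
apply: (H (Num.max (theta x - e) (1/2)) 1); try lra.
- by rewrite gt_max; lra.
- by rewrite le_max lexx.
Qed.

Lemma phi_mixing : topologically_mixing (@phi R).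
Proof.
move=> A B oA A0 oB [z Bz]; have [a [b [a0 ab b1 _ abA]]] := open_itv oA A0.
have [N NP] := iterF_exact (ltW a0) ab (ltW b1).
exists N => n nN; have [t tab tE] := NP n nN _ (theta_itv z).
exists z; split=> //; exists (chi t); first exact: abA.
by apply: theta_inj; rewrite theta_iter chiK//; lra.
Qed.

Lemma phi_periodic_dense : dense (@irrational_periodic_points R).
Proof.
move=> A A0 oA; have [a [b [a0 ab b1 abh abA]]] := open_itv oA A0.
have [t [n [tab n0 tE]]] := periodic_in_itv (ltW a0) ab (ltW b1).
have t01 : 0 <= t <= 1 by lra.
exists (chi t); split; first exact: abA.
split.
  by exists n => //; apply: theta_inj; rewrite theta_iter chiK.
exists (t^-1 - 1); split; first by rewrite subr_gt0 invf_gt1; lra.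
  move=> [q _ qt].
  have : rational t.
    exists (1 + q)^-1 => //; rewrite fmorphV rmorphD rmorph1 /= qt.
    by rewrite [1 + _]addrC subrK invrK.
  move=> /(periodic_rational n0 tE t01); rewrite !inE => /or3P[] /eqP te.
  - lra.
  - by have := abh _ tab; rewrite te eqxx.
  - lra.
by rewrite chi_val ifT//; lra.
Qed.

End coordinate.

(** * The entropy of phi *)

Section entropy_phi.
Context {R : realType}.
Notation X := (set_type (@ext_halfline R)).
Implicit Types (x y : X) (t s : R) (U : set (set X)) (n k : nat).

(** Lebesgue's number lemma on [0,1], carried to the cover through theta. *)
Lemma theta_lebesgue U : open_covering U -> exists2 e : R, 0 < e &
  forall x, exists2 A, U A & forall y, `|theta y - theta x| < e -> A y.
Proof.
move=> [Uo Uc].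
pose P (n : nat) (t : R) := 0 <= t <= 1 -> exists2 A, U A &
  forall y, `|theta y - t| < n.+1%:R^-1 -> A y.
have : compact `[(0:R), 1] by exact: segment_compact.
move=> /compact_near_coveringP /(_ nat \oo P _)[t /=|N _ NP].
  rewrite in_itv/= => t01.
  have : (\bigcup_(A in U) A) (chi t) by rewrite Uc.
  move=> [A UA At].
  have [e e0 eA] := nbhs_theta (open_nbhs_nbhs (conj (Uo _ UA) At)).
  rewrite chiK// in eA.
  exists (ball t (e / 2), [set n | 2 / e < n.+1%:R]) => /=.
    split; first by apply: nbhsx_ballx; lra.
    exists (Num.truncn (2 / e)) => // n /= nt.
    apply: lt_le_trans (truncnS_gt _) _; by rewrite ler_nat ltnS.
  move=> [s n] /= [ts ne] s01; exists A => // y ys; apply: eA.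
  have n0 : 0 < n.+1%:R :> R by rewrite ltr0n.
  have ne' : n.+1%:R^-1 < e / 2.
    by rewrite -[e / 2]invrK ltf_pV2 ?posrE ?invr_gt0 ?divr_gt0// invf_div.
  rewrite -(subrKA s); apply: le_lt_trans (ler_normD _ _) _.
  have ys' := lt_trans ys ne'.
  have ts' : `|s - t| < e / 2 by rewrite distrC.
  by rewrite [e]splitr ltrD.
exists N.+1%:R^-1; first by rewrite invr_gt0 ltr0n.
move=> x; apply: (NP N _ (theta x)) => //=; last exact: theta_itv.
by rewrite in_itv/=; exact: theta_itv.
Qed.

Lemma phi_coded U (lambda : R) : 1 < lambda -> lambda ^+ 2 = lambda + 1 ->
  open_covering U -> exists2 C : R, 0 < C & forall n,
  exists2 K, coded (iterated_join (@phi R) U n) K & K%:R <= C * lambda ^+ n.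
Proof.
move=> l1 lE oU; have [e e0 eU] := theta_lebesgue oU.
have [B [B01 Bh Be]] := grid e0.
have mB : 0 <= mass lambda B.
  by apply: le_trans (size_le_mass l1 B); rewrite ler0n.
pose c := mass lambda B / (lambda - 1).
have c0 : 0 <= c by rewrite divr_ge0// subr_ge0 ltW.
exists (2 * (mass lambda B + c) + 1); first by lra.
move=> n; exists (2 * size (refinement B n)).+1; last first.
  have h1 := mass_refinement l1 lE n B01; rewrite -/c in h1.
  have h2 := size_le_mass l1 (refinement B n).
  have h3 : 1 <= lambda ^+ n by rewrite exprn_ege1 ?ltW.
  rewrite -natr1 natrM [X in _ <= X]mulrDl mul1r -[2 * _ * _]mulrA.
  apply: lerD => //; rewrite ler_pM2l//; apply: le_trans h2 _.
  by apply: le_trans h1; rewrite lerDl.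
exists (fun x => position (refinement B n) (theta x)) => [x|x].
  exact: position_lt.
have /choice[a aP] : forall i, exists A, U A /\
    forall y, `|theta y - theta (iter i (@phi R) x)| < e -> A y.
  by move=> i; have [A UA Ae] := eU (iter i (@phi R) x); exists A.
exists [set y | forall i, (i < n)%N -> a i (iter i (@phi R) y)].
  by apply/iterated_joinP; exists a => // i _; case: (aP i).
move=> y /position_inj H i ni; have [_] := aP i; apply.
rewrite !theta_iter; apply: Be; try exact/iterF_itv/theta_itv.
exact: (inseparable_iter B01 Bh (theta_itv y) (theta_itv x) H (ltnW ni)).
Qed.

(** Here theta >= t and theta <= t are the two halves of A: on each of them the
k-th iterate is injective. *)
Definition fold_cover k : set (set X) := [set A | open A /\
  exists t, forall b x y, A x -> A y -> side b t (theta x) -> side b t (theta y) ->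
    iter k (@phi R) x = iter k (@phi R) y -> x = y].

Lemma fold_cover_open k : open_covering (fold_cover k).
Proof.
split; first by move=> A [].
apply/seteqP; split=> // x _.
have [e1 e10 [_ inj1]] := one_sided_germ k true (theta_itv x).
have [e2 e20 [_ inj2]] := one_sided_germ k false (theta_itv x).
exists [set y | `|theta y - theta x| < Num.min e1 e2]; last first.
  by rewrite /= subrr normr0 lt_min e10.
split; first exact: open_theta_ball.
exists (theta x) => b y z /=.
rewrite !lt_min => /andP[y1 y2] /andP[z1 z2] sy sz.
move=> /(congr1 theta); rewrite !theta_iter => yz; apply: theta_inj.
by case: b sy sz => sy sz; [apply: inj1 yz | apply: inj2 yz];
  split=> //; exact: theta_itv.
Qed.

(** Split S into the two halves of its first set.  The k-th iterate is injective
on each half and shifts the itinerary by k, so n decreases by one while the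
bound doubles. *)
Lemma size_fold_le k n (a : nat -> set X) (S : seq X) (p : X) :
  (forall i, (i < n * k)%N -> fold_cover k (a i)) -> uniq S ->
  (forall x, x \in S -> iter (n * k) (@phi R) x = p) ->
  (forall x, x \in S -> forall i, (i < n * k)%N -> a i (iter i (@phi R) x)) ->
  (size S <= 2 ^ n)%N.
Proof.
elim: n a S => [|n IH] a S aF uS Sp Sa.
  case: S uS Sp {Sa} => [//|x [//|y S]] /=; rewrite inE => /andP[xy _] Sp.
  have xp : x = p by apply: (Sp x); exact: mem_head.
  have yp : y = p by apply: (Sp y); rewrite !inE eqxx orbT.
  by move: xy; rewrite negb_or xp yp eqxx.
(* For k = 0 the join is trivial, and the hypotheses for n and n+1 agree. *)
case: k => [|k] in IH aF Sp Sa *.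
  have /= H := IH a S _ uS; apply: leq_trans (H _ _ _) _; rewrite ?muln0//.
  - by move=> x /Sp; rewrite muln0.
  - by rewrite leq_exp2l.
have [_ [t tP]] := aF 0%N isT.
have half b : (size [seq x <- S | `[< side b t (theta x) >] ] <= 2 ^ n)%N.
  rewrite -(size_map (iter k.+1 (@phi R))).
  apply: (IH (fun i => a (k.+1 + i)%N)).
  - by move=> i ni; apply: aF; rewrite mulSn ltn_add2l.
  - rewrite map_inj_in_uniq ?filter_uniq// => x y.
    rewrite !mem_filter => /andP[/asboolP sx xS] /andP[/asboolP sy yS].
    by apply: (tP b); rewrite ?(Sa x xS 0%N isT) ?(Sa y yS 0%N isT)//;
       [exact: (Sa x xS 0%N)|exact: (Sa y yS 0%N)].
  - move=> _ /mapP[x + ->]; rewrite mem_filter => /andP[_ xS].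
    by rewrite -iterD addnC -mulSn Sp.
  - move=> _ /mapP[x + ->]; rewrite mem_filter => /andP[_ xS] i ni.
    by rewrite -iterD addnC; apply: Sa; rewrite // mulSn addnC ltn_add2l.
have -> : (size S <= 2 ^ n.+1)%N = (size S <= 2 ^ n + 2 ^ n)%N.
  by rewrite expnS mul2n addnn.
apply: leq_trans (leq_add (half true) (half false)).
rewrite !size_filter -size_filter.
rewrite -(count_predC (fun x => `[< side true t (theta x) >])).
rewrite size_filter leq_add2l.
apply: sub_count => x /= /asboolPn; rewrite /side => /negP h.
by apply/asboolP; rewrite leNgt; apply: contraNN h; exact: ltW.
Qed.

(** Sort the preimages of order nk by their code: each class lies in one member of
the join. *)
Lemma coded_fold_ge k n K (lambda : R) : 1 < lambda -> lambda ^+ 2 = lambda + 1 ->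
  coded (iterated_join (@phi R) (fold_cover k) (n * k)) K ->
  lambda ^+ (n * k) <= K%:R * 2 ^+ n.
Proof.
move=> l1 lE [g gK gA].
apply: le_trans (size_preorbit l1 lE (n * k)) _.
rewrite -natrX -natrM ler_nat.
pose S := [seq chi t | t <- preorbit (n * k) : seq R].
have SP t : t \in (preorbit (n * k) : seq R) -> 0 <= t <= 1 by move=> /preorbitP[].
have uS : uniq S.
  rewrite map_inj_in_uniq ?preorbit_uniq// => s t /SP s01 /SP t01.
  by move=> /(congr1 theta); rewrite !chiK.
have Sp x : x \in S -> iter (n * k) (@phi R) x = chi (2/3).
  move=> /mapP[t /preorbitP[t01 tE] ->]; apply: theta_inj.
  by rewrite theta_iter !chiK// ?tE//; lra.
rewrite -[size _](size_map (@chi R)) -/S.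
have -> : size S = (\sum_(c < K) count (fun x => g x == c) S)%N.
  under eq_bigr do rewrite -sum1_count.
  rewrite -sum1_size (exchange_big_dep predT)//=.
  by apply: eq_bigr => x _; rewrite (big_pred1 (Ordinal (gK x))).
rewrite -[K in (K * _)%N]card_ord -sum_nat_const; apply: leq_sum => c _.
rewrite -size_filter.
case Sc : [seq x <- S | g x == c] => [//|x0 S0]; rewrite -Sc.
have : x0 \in [seq x <- S | g x == c] by rewrite Sc mem_head.
rewrite mem_filter => /andP[/eqP gx0 _].
have [A /iterated_joinP[a aU ->] Ag] := gA x0.
apply: (@size_fold_le k n a _ (chi (2/3)) aU).
- exact: filter_uniq.
- by move=> x; rewrite mem_filter => /andP[_]; exact: Sp.
- move=> x; rewrite mem_filter => /andP[/eqP gx _]; apply: Ag.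
  by rewrite gx gx0.
Qed.

Lemma entropy_phi (lambda : R) : 1 < lambda -> lambda ^+ 2 = lambda + 1 ->
  topological_entropy R (@phi R) = (ln lambda)%:E.
Proof.
move=> l1 lE; have l0 : 0 < lambda by lra.
have fin U : open_covering U ->
    forall n, exists K, coded (iterated_join (@phi R) U n) K.
  by move=> /(phi_coded l1 lE)[C _ H] n; have [K] := H n; exists K.
apply/eqP; rewrite eq_le; apply/andP; split.
  apply: ge_ereal_sup => _ [U oU <-]; rewrite lee_fin.
  have [C C0 H] := phi_coded l1 lE oU.
  exact: (entropy_rel_le (chi 0) (fin U oU) C0 l0 H).
apply/lee_subgt0Pr => e e0.
(* The loss (ln 2)/k of the k-th cover is then at most e. *)
pose k := (Num.truncn (ln 2 / e)).+1.
have kP : ln 2 / e < k%:R by exact: truncnS_gt.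
have kE : k%:R^-1 * ln 2 <= e.
  rewrite mulrC ler_pdivrMr ?ltr0n// mulrC -ler_pdivrMr//; exact: ltW.
have oU := fold_cover_open k.
apply: (@le_trans _ _ (entropy_rel R (@phi R) (fold_cover k))%:E); last first.
  by apply: ereal_sup_ubound; exists (fold_cover k).
rewrite -EFinB lee_fin.
have := entropy_rel_ge (chi 0) (fin _ oU) (isT : (0 < k)%N) l0
  (fun n K => @coded_fold_ge k n K lambda l1 lE).
by lra.
Qed.

End entropy_phi.

Section golden.
Context {R : realType}.

Definition golden : R := (1 + Num.sqrt 5) / 2.

Lemma sqr_sqrt5 : Num.sqrt 5 ^+ 2 = 5 :> R.
Proof. by rewrite sqr_sqrtr. Qed.

Lemma golden_gt1 : 1 < golden.
Proof.
have h : 1 < Num.sqrt 5 :> R by rewrite -[X in X < _]sqrtr1 ltr_sqrt; lra.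
by rewrite /golden ltr_pdivlMr; lra.
Qed.

Lemma golden_sqr : golden ^+ 2 = golden + 1.
Proof.
by rewrite /golden; have := sqr_sqrt5; rewrite !expr2; lra.
Qed.

Lemma root_cubicE (x : R) :
  root ('X^3 - 2 *: 'X - 1) x = (x ^+ 2 == x + 1) || (x == - 1).
Proof.
rewrite /root !hornerE.
rewrite -[x ^+ 2 == _]subr_eq0 -[x == - 1]subr_eq0 -mulf_eq0.
by congr (_ == _); ring.
Qed.

End golden.

Theorem mainTheorem1 (R : realType) :
  [/\ continuous (@phi R),
      topologically_mixing (@phi R),
      dense (@irrational_periodic_points R) &
      exists2 lambda : R,
        unique (fun x : R => 0 < x /\ root ('X^3 - 2 *: 'X - 1) x) lambda &
        topological_entropy R (@phi R) = (ln lambda)%:E].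
Proof.
split.
- exact: phi_continuous.
- exact: phi_mixing.
- exact: phi_periodic_dense.
exists golden; last exact: entropy_phi golden_gt1 golden_sqr.
have g1 := @golden_gt1 R; have g2 := @golden_sqr R.
split; first by rewrite root_cubicE g2 eqxx; split=> //; lra.
move=> x [x0]; rewrite root_cubicE => /orP[|] /eqP xE; last by lra.
(* Both are zeros of X^2 - X - 1, and golden + x > 1. *)
have : (golden - x) * (golden + x - 1) = 0 by rewrite !expr2 in g2 xE; lra.
by move=> /eqP; rewrite mulf_eq0 => /orP[|] /eqP; lra.
Qed.
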